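(* Let $n\ge2$ be an integer and let $f:\mathbb{B}\to\mathbb{H}$ be a slice regular function such that $\tilde d_n(f(\mathbb{B}))=d_n(\mathbb{B})$. Then $$\tilde d_n(f(r\mathbb{B}))\le d_n(r\mathbb{B})\quad\text{for all } r\in(0,1)$$ and $$|\partial_c f(0)|\le1.$$
   Context: $\mathbb{H}$ denotes the skew field of quaternions with its usual modulus, $\mathbb{B}=\{q\in\mathbb{H}:|q|<1\}$, $r\mathbb{B}=\{q\in\mathbb{H}:|q|<r\}$, $\mathbb{S}=\{q\in\mathbb{H}:q^2=-1\}$, and for $I\in\mathbb{S}$, $L_I=\mathbb{R}+\mathbb{R}I$ and $\mathbb{B}_I=\mathbb{B}\cap L_I$. A function $f:\mathbb{B}\to\mathbb{H}$ is slice regular if for every $I\in\mathbb{S}$ its restriction $f_I$ to $\mathbb{B}_I$ has continuous partial derivatives and satisfies $\frac12\big(\frac{\partial}{\partial x}+I\frac{\partial}{\partial y}\big)f_I(x+yI)=0$ on $\mathbb{B}_I$. Equivalently, $f(q)=\sum_{m\ge0}q^ma_m$ with $a_m\in\mathbb{H}$, converging absolutely and uniformly on compact subsets of $\mathbb{B}$. The slice derivative is $\partial_c f(x+yI)=\frac{\partial}{\partial x}f(x+yI)$; in particular $\partial_c f(0)=a_1$. The $*$-product of $f(q)=\sum_{m\ge0} q^ma_m$ and $g(q)=\sum_{m\ge0} q^mb_m$ is $f*g(q)=\sum_{m\ge0}q^m\sum_{k=0}^m a_kb_{m-k}$; it is associative but not commutative. For $u\in\overline{\mathbb{B}}$ put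 $f_u(q)=\sum_{m\ge0}q^mu^ma_m$. For $E\subset\mathbb{H}$ the $n$-diameter is $d_n(E)=\sup_{w_1,\dots,w_n\in E}\big(\prod_{1\le j<k\le n}|w_k-w_j|\big)^{\frac{2}{n(n-1)}}$. For $r\in(0,1)$ the regular $n$-diameter of the image of $r\mathbb{B}$ is $$\tilde d_n(f(r\mathbb{B}))=\max_{w_1,\dots,w_n\in\overline{\mathbb{B}}}\ \max_{|q|\le r}\big|P_{w_1,\dots,w_n}(q)\big|^{\frac{2}{n(n-1)}},$$ where $P_{w_1,\dots,w_n}$ is the $*$-product of the functions $f_{w_k}-f_{w_j}$ over all pairs $(j,k)$ with $1\le j<k\le n$, the factors being ordered according to the lexicographic order of $(j,k)$. Moreover $\tilde d_n(f(\mathbb{B}))=\lim_{r\to1^-}\tilde d_n(f(r\mathbb{B}))$ (the limit of a non-decreasing function of $r$, possibly $+\infty$). *)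

(* Defs.v *)
From HB Require Import structures.
From mathcomp Require Import all_boot all_order all_algebra.
From mathcomp Require Import ring lra.
From mathcomp Require Import all_classical all_reals all_analysis.
Set Implicit Arguments.
Unset Strict Implicit.
Unset Printing Implicit Defensive.
Import Order.TTheory GRing.Theory Num.Theory.
Import numFieldNormedType.Exports.

Local Open Scope classical_set_scope.
Local Open Scope ring_scope.

(* Quat a b c d stands for a + b i + c j + d k. *)
Record quat (R : realType) := Quat { q0 : R; q1 : R; q2 : R; q3 : R }.

Section Quaternions.
Variable R : realType.
Implicit Types p q : quat R.

Definition quat_to_prod q := (q0 q, q1 q, q2 q, q3 q).
Definition prod_to_quat (x : R * R * R * R) :=
  let: (a, b, c, d) := x in Quat a b c d.
Lemma quat_to_prodK : cancel quat_to_prod prod_to_quat.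
Proof. by case. Qed.

HB.instance Definition _ := Choice.copy (quat R) (can_type quat_to_prodK).

Definition quat_add p q :=
  Quat (q0 p + q0 q) (q1 p + q1 q) (q2 p + q2 q) (q3 p + q3 q).
Definition quat_opp p := Quat (- q0 p) (- q1 p) (- q2 p) (- q3 p).

Lemma quat_addA : associative quat_add.
Proof. by case=> ? ? ? ? [? ? ? ?] [? ? ? ?]; congr Quat; rewrite /= addrA. Qed.
Lemma quat_addC : commutative quat_add.
Proof. by case=> ? ? ? ? [? ? ? ?]; congr Quat; rewrite /= addrC. Qed.
Lemma quat_add0 : left_id (Quat 0 0 0 0) quat_add.
Proof. by case=> ? ? ? ?; congr Quat; rewrite /= add0r. Qed.
Lemma quat_addN : left_inverse (Quat 0 0 0 0) quat_opp quat_add.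
Proof. by case=> ? ? ? ?; congr Quat; rewrite /= addNr. Qed.

HB.instance Definition _ := GRing.isZmodule.Build (quat R)
  quat_addA quat_addC quat_add0 quat_addN.

Definition quat_mul p q :=
  Quat (q0 p * q0 q - q1 p * q1 q - q2 p * q2 q - q3 p * q3 q)
       (q0 p * q1 q + q1 p * q0 q + q2 p * q3 q - q3 p * q2 q)
       (q0 p * q2 q - q1 p * q3 q + q2 p * q0 q + q3 p * q1 q)
       (q0 p * q3 q + q1 p * q2 q - q2 p * q1 q + q3 p * q0 q).

Lemma quat_mulA : associative quat_mul.
Proof. by case=> ? ? ? ? [? ? ? ?] [? ? ? ?]; congr Quat => /=; ring. Qed.
Lemma quat_mul1l : left_id (Quat 1 0 0 0) quat_mul.
Proof. by case=> ? ? ? ?; congr Quat => /=; ring. Qed.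
Lemma quat_mul1r : right_id (Quat 1 0 0 0) quat_mul.
Proof. by case=> ? ? ? ?; congr Quat => /=; ring. Qed.
Lemma quat_mulDl : left_distributive quat_mul +%R.
Proof. by case=> ? ? ? ? [? ? ? ?] [? ? ? ?]; congr Quat => /=; ring. Qed.
Lemma quat_mulDr : right_distributive quat_mul +%R.
Proof. by case=> ? ? ? ? [? ? ? ?] [? ? ? ?]; congr Quat => /=; ring. Qed.
Lemma quat_1neq0 : Quat 1 0 0 0 != 0 :> quat R.
Proof. by apply/eqP => -[] /eqP; rewrite oner_eq0. Qed.

HB.instance Definition _ := GRing.Zmodule_isNzRing.Build (quat R)
  quat_mulA quat_mul1l quat_mul1r quat_mulDl quat_mulDr quat_1neq0.

Definition quat_scale (a : R) q := Quat (a * q0 q) (a * q1 q) (a * q2 q) (a * q3 q).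

Lemma quat_scaleA a b q : quat_scale a (quat_scale b q) = quat_scale (a * b) q.
Proof. by congr Quat; rewrite /= mulrA. Qed.
Lemma quat_scale1 : left_id 1 quat_scale.
Proof. by case=> ? ? ? ?; congr Quat; rewrite /= mul1r. Qed.
Lemma quat_scaleDr : right_distributive quat_scale +%R.
Proof. by move=> ? ? ?; congr Quat; rewrite /= mulrDr. Qed.
Lemma quat_scaleDl q : {morph quat_scale^~ q : a b / a + b}.
Proof. by move=> ? ?; congr Quat; rewrite /= mulrDl. Qed.

HB.instance Definition _ := GRing.Zmodule_isLmodule.Build R (quat R)
  quat_scaleA quat_scale1 quat_scaleDr quat_scaleDl.

Lemma quat_scaleAl (a : R) (p q : quat R) : a *: (p * q) = (a *: p) * q.
Proof. by congr Quat => /=; ring. Qed.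
HB.instance Definition _ := GRing.Lmodule_isLalgebra.Build R (quat R) quat_scaleAl.

Lemma quat_scaleAr (a : R) (p q : quat R) : a *: (p * q) = p * (a *: q).
Proof. by congr Quat => /=; ring. Qed.
HB.instance Definition _ := GRing.Lalgebra_isAlgebra.Build R (quat R) quat_scaleAr.

Definition quat_norm q :=
  Num.sqrt (q0 q ^+ 2 + q1 q ^+ 2 + q2 q ^+ 2 + q3 q ^+ 2).

Lemma quat_sqr_ge0 q : 0 <= q0 q ^+ 2 + q1 q ^+ 2 + q2 q ^+ 2 + q3 q ^+ 2.
Proof. by rewrite !addr_ge0 ?sqr_ge0. Qed.

Lemma quat_ler_normD p q : quat_norm (p + q) <= quat_norm p + quat_norm q.
Proof.
have Np := quat_sqr_ge0 p; have Nq := quat_sqr_ge0 q.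
rewrite -ler_sqr ?nnegrE ?addr_ge0 ?sqrtr_ge0// sqrrD /quat_norm.
rewrite !sqr_sqrtr ?quat_sqr_ge0// -sqrtrM//.
pose s := q0 p * q0 q + q1 p * q1 q + q2 p * q2 q + q3 p * q3 q.
have : s <= Num.sqrt ((q0 p ^+ 2 + q1 p ^+ 2 + q2 p ^+ 2 + q3 p ^+ 2) *
                      (q0 q ^+ 2 + q1 q ^+ 2 + q2 q ^+ 2 + q3 q ^+ 2)).
  rewrite (le_trans (ler_norm s))// -sqrtr_sqr ler_wsqrtr// -subr_ge0.
  rewrite [leRHS](_ : _ =
    (q0 p * q1 q - q1 p * q0 q) ^+ 2 + (q0 p * q2 q - q2 p * q0 q) ^+ 2 +
    (q0 p * q3 q - q3 p * q0 q) ^+ 2 + (q1 p * q2 q - q2 p * q1 q) ^+ 2 +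
    (q1 p * q3 q - q3 p * q1 q) ^+ 2 + (q2 p * q3 q - q3 p * q2 q) ^+ 2).
    by rewrite !addr_ge0 ?sqr_ge0.
  by rewrite /s; ring.
rewrite /s /=; set t := Num.sqrt _; move=> st; rewrite -subr_ge0.
rewrite [leRHS](_ : _ = (t - s) *+ 2) ?mulrn_wge0 ?subr_ge0//.
by rewrite /s; ring.
Qed.

Lemma quat_normZ (a : R) q : quat_norm (a *: q) = `|a| * quat_norm q.
Proof.
by rewrite /quat_norm /= !exprMn -!mulrDr sqrtrM ?sqr_ge0// sqrtr_sqr.
Qed.

Lemma quat_norm0_eq0 q : quat_norm q = 0 -> q = 0.
Proof.
move=> /eqP; rewrite sqrtr_eq0 => h.
have := conj h (quat_sqr_ge0 q) => /andP; rewrite -eq_le.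
rewrite !paddr_eq0 ?addr_ge0 ?sqr_ge0// !sqrf_eq0.
by case: q {h} => a b c d /= /andP[/andP[/andP[/eqP-> /eqP->] /eqP->] /eqP->].
Qed.

(* The norm `|q| and the topology of quat R are those of the modulus. *)
HB.instance Definition _ := @Lmodule_isNormed.Build R (quat R)
  quat_norm quat_ler_normD quat_normZ quat_norm0_eq0.

End Quaternions.

Section SliceRegular.
Variable R : realType.
Implicit Types (f g : quat R -> quat R) (a : nat -> quat R) (q u : quat R).

Definition qball (r : R) : set (quat R) := [set q | `|q| < r].

Definition imag_units : set (quat R) := [set I | I ^+ 2 = -1].

(* The restriction of f to the plane L_I in the coordinates (x, y) of x + y I. *)
Definition slice f (I : quat R) (z : R * R) : quat R := f (z.1%:A + z.2 *: I).

(* Functions on the unit ball are total functions whose values outside the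
   ball are irrelevant. *)
Definition slice_regular f := forall I, imag_units I ->
  forall z : R * R, qball 1 (z.1%:A + z.2 *: I) ->
  [/\ derivable (slice f I) z (1, 0) /\ derivable (slice f I) z (0, 1),
      {for z, continuous ('D_(1, 0) (slice f I))},
      {for z, continuous ('D_(0, 1) (slice f I))} &
      2^-1 *: ('D_(1, 0) (slice f I) z + I * 'D_(0, 1) (slice f I) z) = 0].

(* At q = x + y I, the derivative of t |-> f ((x + t) + y I) at t = 0; it does
   not depend on I, hence makes sense at real q as well. *)
Definition slice_derivative f q : quat R := 'D_1 f q.

Definition power_series a q : quat R :=
  limn (series (fun m => q ^+ m * a m)).

Definition has_expansion f a := forall q, qball 1 q ->
  series (fun m => q ^+ m * a m) @ \oo --> f q.

(* The coefficients (a_m) of f, unique when they exist. *)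
Definition coefs f : nat -> quat R := xget (fun=> 0) [set a | has_expansion f a].

Definition star f g q : quat R :=
  power_series (fun m => \sum_(k < m.+1) coefs f k * coefs g (m - k)%N) q.

(* f_u(q) = sum_m q^m u^m a_m where f(q) = sum_m q^m a_m *)
Definition rotate f u q : quat R := power_series (fun m => u ^+ m * coefs f m) q.

Definition ndiam (n : nat) (E : set (quat R)) : \bar R :=
  ereal_sup [set ((\prod_(j < n) \prod_(k < n | (j < k)%N) `|w k - w j|)
                    `^ (2 / (n * n.-1)%N%:R))%:E
            | w in [set w : 'I_n -> quat R | forall i, E (w i)]].

(* The big operators enumerate indices increasingly and do not permute factors,
   so the factors come in the lexicographic order of (j, k). *)
Definition star_vandermonde n f (w : 'I_n -> quat R) : quat R -> quat R :=
  \big[star/cst 1]_(j < n) \big[star/cst 1]_(k < n | (j < k)%N)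
    (rotate f (w k) \- rotate f (w j)).

(* For 0 < r < 1 and f slice regular both suprema are maxima, by compactness. *)
Definition regular_ndiam n f (r : R) : \bar R :=
  ereal_sup [set ereal_sup [set (`|star_vandermonde f w q|
                                   `^ (2 / (n * n.-1)%N%:R))%:E
                           | q in [set q | `|q| <= r]]
            | w in [set w : 'I_n -> quat R | forall i, `|w i| <= 1]].

Definition regular_ndiam1 n f : \bar R := lim (regular_ndiam n f r @[r --> 1^'-]).

End SliceRegular.

(* Main.v *)
Require Import Defs.
From mathcomp Require Import all_boot all_order all_algebra.
From mathcomp Require Import ring lra zify.
From mathcomp Require Import all_classical all_reals all_analysis.
Import Order.TTheory GRing.Theory Num.Theory.
Import numFieldNormedType.Exports.
Local Open Scope classical_set_scope.
Local Open Scope ring_scope.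
Set Implicit Arguments.
Unset Strict Implicit.
Unset Printing Implicit Defensive.

(** Write f(q) = sum_m q^m a_m and let N = n (n - 1) / 2 be the number of pairs
    j < k. The constant terms cancel in f_(w_k) - f_(w_j), which therefore starts
    with q (w_k - w_j) a_1, and the star product P_w of these N factors starts
    with q^N c_N, where |c_N| = prod_(j < k) |w_k - w_j| |a_1|^N because the modulus
    is multiplicative (leading_term_star_vandermonde).

    Put d = d_n(B). The regular diameter is nondecreasing in the radius, so the
    assumption gives |P_w|^(1/N) <= d, that is |P_w| <= d^N, on the whole unit
    ball and for all w in the closed ball. Dividing by q^N and using the maximum
    principle, as in Schwarz's lemma (schwarz_ball), one gets

      |P_w(q)| <= |q|^N d^N    and    |c_N| <= d^N.

    Taking N-th roots, the first bound says that the regular diameter of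
    f(r B) is at most r d = d_n(r B). The second one says that
    (prod_(j < k) |w_k - w_j|)^(1/N) |a_1| <= d; taking the supremum over w in the
    ball gives d |a_1| <= d, hence |a_1| <= 1 since 0 < d < +oo.

    The analytic core is the maximum principle for power series with
    coefficients on the right. For a polynomial it comes from averaging over the
    K-th roots of unity of the plane L_I through the point, against a discrete
    version of the Poisson kernel, which is nonnegative
    (polynomial_maximum_principle); partial sums then approximate a power series
    with geometric errors.

    Finally, a function has at most one expansion (expansion_unique), so that the
    coefficients of star products are computed by convolution, and f does have
    an expansion: otherwise its coefficients are zero by convention and its
    regular diameter is 0, whereas d > 0 (diameter_has_expansion). *)

(** * The modulus of a quaternion *)

Section Modulus.
Variable R : realType.
Implicit Types (p q x z : quat R) (a b t : R).

Definition quat_conj q := Quat (q0 q) (- q1 q) (- q2 q) (- q3 q).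

Lemma quat_normE q :
  `|q| = Num.sqrt (q0 q ^+ 2 + q1 q ^+ 2 + q2 q ^+ 2 + q3 q ^+ 2).
Proof. by []. Qed.

Lemma quat_eqP p q : q0 p = q0 q -> q1 p = q1 q -> q2 p = q2 q ->
  q3 p = q3 q -> p = q.
Proof. by case: p q => [? ? ? ?] [? ? ? ?] /= -> -> -> ->. Qed.

Lemma quat_normM p q : `|p * q| = `|p| * `|q|.
Proof.
rewrite !quat_normE -sqrtrM ?quat_sqr_ge0//; congr Num.sqrt.
by case: p q => [? ? ? ?] [? ? ? ?] /=; ring.
Qed.

Lemma quat_norm1 : `|1 : quat R| = 1.
Proof. by rewrite quat_normE /= expr1n expr0n !addr0 sqrtr1. Qed.

Lemma quat_normX q m : `|q ^+ m| = `|q| ^+ m.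
Proof.
by elim: m => [|m IH]; rewrite ?expr0 ?quat_norm1// !exprS quat_normM IH.
Qed.

Lemma quat_norm_unity_root q K : (0 < K)%N -> q ^+ K = 1 -> `|q| = 1.
Proof.
move=> K0 qK; apply/eqP; rewrite -(@pexpr_eq1 _ _ K)//.
by rewrite -quat_normX qK quat_norm1.
Qed.

Lemma quat_norm_scalar a : `|a%:A : quat R| = `|a|.
Proof. by rewrite normrZ quat_norm1 mulr1. Qed.

Lemma quat_eq0 q : (q == 0) = (`|q| == 0).
Proof. by rewrite normr_eq0. Qed.

Lemma quat_mulf_eq0 p q : p * q = 0 -> p != 0 -> q = 0.
Proof.
move=> pq0 p0; apply/eqP; rewrite quat_eq0.
move/eqP: pq0; rewrite quat_eq0 quat_normM mulf_eq0 normr_eq0.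
by rewrite (negPf p0).
Qed.

Lemma quat_mul_conj q : q * quat_conj q = (`|q| ^+ 2)%:A.
Proof.
rewrite quat_normE sqr_sqrtr ?quat_sqr_ge0//.
by apply: quat_eqP; case: q => [? ? ? ?] /=; ring.
Qed.

Lemma quat_conj_one_sub t x :
  quat_conj (1 - t *: x) = 1 - t *: quat_conj x.
Proof. by apply: quat_eqP; case: x => [? ? ? ?] /=; ring. Qed.

Lemma quat_component_le q :
  [/\ `|q0 q| <= `|q|, `|q1 q| <= `|q|, `|q2 q| <= `|q| & `|q3 q| <= `|q|].
Proof.
have h a b : 0 <= b -> `|a| <= Num.sqrt (a ^+ 2 + b).
  by move=> b0; rewrite -sqrtr_sqr ler_wsqrtr// lerDl.
case: q => a b c d; rewrite quat_normE /=; split.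
- by rewrite -!addrA h// !addr_ge0 ?sqr_ge0.
- by rewrite [a ^+ 2 + _]addrC -!addrA h// !addr_ge0 ?sqr_ge0.
- by rewrite addrAC [_ + c ^+ 2]addrC h// !addr_ge0 ?sqr_ge0.
- by rewrite [_ + d ^+ 2]addrC h// !addr_ge0 ?sqr_ge0.
Qed.

Lemma quat_norm_le_sum q :
  `|q| <= `|q0 q| + `|q1 q| + `|q2 q| + `|q3 q|.
Proof.
have -> : q = Quat (q0 q) 0 0 0 + Quat 0 (q1 q) 0 0
  + Quat 0 0 (q2 q) 0 + Quat 0 0 0 (q3 q).
  by apply: quat_eqP; case: q => [? ? ? ?] /=; ring.
rewrite /= !add0r !addr0.
have h a : Num.sqrt (a ^+ 2) = `|a| by rewrite sqrtr_sqr.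
do 3?[apply: (le_trans (ler_normD _ _)); apply: lerD].
all: by rewrite quat_normE /= expr0n !(add0r, addr0) h.
Qed.

(** Every quaternion lies in a plane L_I: normalize its imaginary part, or take
    any I when the quaternion is real. *)
Lemma exists_imag_unit_comm z : exists2 I, imag_units I & I * z = z * I.
Proof.
case: z => a b c d.
pose v : quat R := Quat 0 b c d.
have v2 : v ^+ 2 = (- (`|v| ^+ 2))%:A.
  rewrite quat_normE sqr_sqrtr ?quat_sqr_ge0// expr2.
  by apply: quat_eqP => /=; ring.
have [v0|v0] := eqVneq v 0.
  exists (Quat 0 1 0 0); first by apply: quat_eqP => /=; ring.
  by case: v0 => -> -> ->; apply: quat_eqP => /=; ring.
exists (`|v|^-1 *: v).
  rewrite /imag_units /= exprZn v2 scalerA mulrN exprVn mulVf ?scaleN1r//.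
  by rewrite expf_neq0// normr_eq0.
by apply: quat_eqP => /=; ring.
Qed.

Lemma imag_unit_re0 (I : quat R) : imag_units I -> q0 I = 0.
Proof.
case: I => a b c d; rewrite /imag_units /= expr2 => I2.
have [/= e0 e1 e2 e3] : [/\ a * a - b * b - c * c - d * d = -1,
    a * b = 0, a * c = 0 & a * d = 0].
  move: (congr1 (@q0 R) I2) (congr1 (@q1 R) I2) (congr1 (@q2 R) I2)
    (congr1 (@q3 R) I2) => /=; rewrite oppr0; split; lra.
apply/eqP; rewrite -sqrf_eq0 -[_ == 0]orbF.
have a1 : a ^+ 2 + 1 != 0 by rewrite gt_eqF// ltr_wpDl ?sqr_ge0.
rewrite -(negPf a1) -mulf_eq0; apply/eqP.
transitivity ((a * b) ^+ 2 + (a * c) ^+ 2 + (a * d) ^+ 2).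
  by rewrite -[X in a ^+ 2 + X]opprK -e0; ring.
by rewrite e1 e2 e3 expr0n !addr0.
Qed.

End Modulus.

(** * Maximum principle for polynomials with coefficients on the right *)

Section PolynomialMaximumPrinciple.
Variable R : realType.
Implicit Types (I p q x z : quat R) (a b t : R).

(** The way in which limits are taken below: all errors are geometric. *)
Lemma le_geometric_error (x y D kappa : R) : 0 <= kappa < 1 ->
  (forall T, x <= y + D * kappa ^+ T) -> x <= y.
Proof.
move=> /andP[k0 k1] xy.
apply/ler_addgt0Pl => e e0.
have : (fun m => D * kappa ^+ m) @ \oo --> (0 : R).
  by apply: cvg_geometric; rewrite ger0_norm.
move=> /cvgrPdist_lt/(_ e e0)[m _ /(_ m (leqnn m)) /=].
rewrite sub0r normrN => /ltr_normlW; have := xy m; lra.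
Qed.

Definition circle_exp I t : quat R := (cos t)%:A + sin t *: I.

(** De Moivre's formula in the plane L_I. *)
Lemma circle_expX I t k : imag_units I ->
  circle_exp I t ^+ k = circle_exp I (t *+ k).
Proof.
move=> I2; elim: k => [|k IH].
  by rewrite expr0 mulr0n /circle_exp cos0 sin0 scale1r scale0r addr0.
have I2' : I * I = - 1 by rewrite -expr2 I2.
rewrite exprS IH mulrS /circle_exp cosD sinD.
rewrite mulrDl !mulrDr -!scalerAl -!scalerAr !mul1r !mulr1 I2'.
rewrite !scalerA scalerN scalerBl scalerDl -!addrA; congr (_ + _).
by rewrite addrA addrC; congr (_ + _); rewrite addrC.
Qed.

(** Roots of unity have to be sought in the plane L_I that contains z: only then
    do they commute with z, so that w z stays on the sphere of z and
    (w z)^j = w^j z^j. *)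
Lemma root_of_unity_exists z K : (0 < K)%N -> exists w,
  [/\ w * z = z * w, w ^+ K = 1 &
      forall d, (0 < d < K)%N -> \sum_(k < K) w ^+ (k * d) = 0].
Proof.
move=> K0; have [I I2 Iz] := exists_imag_unit_comm z.
have K0' : (K%:R : R) != 0 by rewrite pnatr_eq0 -lt0n.
set w := circle_exp I (pi *+ 2 / K%:R).
have wK : w ^+ K = 1.
  rewrite circle_expX// -[_ / _ *+ _]mulr_natr divfK//.
  by rewrite /circle_exp cos2pi sin2pi scale1r scale0r addr0.
exists w; split => //.
  by rewrite /w /circle_exp mulrDl mulrDr -!scalerAl -!scalerAr Iz mul1r mulr1.
move=> d /andP[d0 dK].
have wd1 : w ^+ d != 1.
  (* The real part of w^d is cos (2 s) = 1 - 2 sin^2 s with 0 < s < pi. *)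
  rewrite /w circle_expX//; apply/eqP => /(congr1 (@q0 R)) /=.
  pose s : R := pi * d%:R / K%:R.
  have -> : pi *+ 2 / K%:R *+ d = s *+ 2 :> R.
    by rewrite /s mulr_natr !mulrnAl mulrnAC.
  have s0 : 0 < sin s.
    apply: sin_gt0_pi; rewrite /s divr_gt0 ?mulr_gt0 ?pi_gt0 ?ltr0n//=.
    by rewrite ltr_pdivrMr ?ltr0n// ltr_pM2l ?pi_gt0// ltr_nat.
  rewrite cos_mulr2n; have := cos2Dsin2 s.
  have := exprn_gt0 2 s0; rewrite imag_unit_re0// mulr1 mulr0 addr0 mulr2n; lra.
apply: (@quat_mulf_eq0 _ (w ^+ d - 1)); last by rewrite subr_eq0.
under eq_bigr do rewrite mulnC exprM.
by rewrite -subrX1 -exprM mulnC exprM wK expr1n subrr.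
Qed.

(** Periodized Poisson kernel on the K-th roots of unity: summing the two
    geometric progressions shows that the sum, multiplied by |1 - rho x|^2, is
    (1 - rho^K) (1 - rho^2). In particular it is a nonnegative real number, and
    this positivity is what makes the maximum principle sharp. *)
Lemma discrete_poisson_real (rho : R) K x : 0 <= rho < 1 -> (0 < K)%N ->
  x ^+ K = 1 -> exists2 t : R, 0 <= t &
  \sum_(l < K) (rho ^+ l + rho ^+ (K - l)) *: x ^+ l = t%:A.
Proof.
move=> /andP[rho0 rho1] K0 xK.
have x1 : `|x| = 1 := quat_norm_unity_root K0 xK.
have xx : x * quat_conj x = 1 by rewrite quat_mul_conj x1 expr1n scale1r.
set S := \sum_(l < K) _.
have rK : rho ^+ K < 1 by rewrite exprn_ilt1// -lt0n.
have S1 : (\sum_(l < K) rho ^+ l *: x ^+ l) * (1 - rho *: x) = (1 - rho ^+ K)%:A.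
  have := subrX1 (rho *: x) K; rewrite exprZn xK.
  move=> e; rewrite scalerBl scale1r -[RHS]opprB e.
  rewrite -mulNr opprB; under eq_bigr do rewrite -exprZn.
  rewrite mulr_suml mulr_sumr; apply: eq_bigr => i _.
  by rewrite mulrBl mulrBr mulr1 mul1r -exprS -exprSr.
have S2 : (\sum_(l < K) rho ^+ (K - l) *: x ^+ l) * (x - rho%:A)
    = (rho * (1 - rho ^+ K))%:A.
  rewrite mulr_suml.
  pose F l := rho ^+ (K - l).+1 *: x ^+ l.
  under eq_bigr => l _.
    rewrite mulrBr -scalerAl -exprSr -scalerAr mulr1 scalerA -exprS -/(F l).
    have -> : rho ^+ (K - l) *: x ^+ l.+1 = F l.+1.
      by rewrite /F subnS prednK// subn_gt0.
    over.
  rewrite -(big_mkord xpredT (fun l => F l.+1 - F l)) telescope_sumr//.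
  rewrite /F subnn subn0 xK expr0 expr1 -scalerBl exprS.
  by congr (_ *: _); ring.
have ST : S * ((1 - rho *: x) * (x - rho%:A)) =
    ((1 - rho ^+ K) * (1 - rho ^+ 2)) *: x.
  rewrite /S; under eq_bigr do rewrite scalerDl.
  rewrite big_split /= mulrDl mulrA S1.
  have -> : (1 - rho *: x) * (x - rho%:A) = (x - rho%:A) * (1 - rho *: x).
    by apply: quat_eqP; case: (x) => [? ? ? ?] /=; ring.
  rewrite mulrA S2 -!scalerAl !mul1r.
  by apply: quat_eqP; case: (x) => [? ? ? ?] /=; ring.
have n0 : 0 < `|1 - rho *: x| ^+ 2.
  rewrite exprn_gt0// normr_gt0 subr_eq0; apply/eqP => e.
  have := congr1 (fun q : quat R => `|q|) e.
  by rewrite quat_norm1 normrZ x1 mulr1 ger0_norm// => /eqP; rewrite gt_eqF.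
exists ((1 - rho ^+ K) * (1 - rho ^+ 2) / `|1 - rho *: x| ^+ 2).
  rewrite divr_ge0 ?(ltW n0)// mulr_ge0// subr_ge0 ?(ltW rK)//.
  by rewrite exprn_ile1// ltW.
have : S * (`|1 - rho *: x| ^+ 2)%:A =
    ((1 - rho ^+ K) * (1 - rho ^+ 2))%:A.
  rewrite -quat_mul_conj quat_conj_one_sub.
  have -> : 1 - rho *: quat_conj x = (x - rho%:A) * quat_conj x.
    by rewrite mulrBl xx -scalerAl mul1r.
  by rewrite [X in S * X]mulrA mulrA ST -scalerAl xx.
rewrite -scalerAr mulr1 => e; rewrite [_ * _]mulrC -scalerA -e scalerA.
by rewrite mulVf ?scale1r// gt_eqF.
Qed.

(** By orthogonality of the powers of w, averaging a polynomial against the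
    kernel damps its j-th coefficient by rho^j, up to the aliasing term
    rho^(K - j) which disappears as K grows. *)
Lemma discrete_poisson_sum (rho : R) K (w : quat R) (x : nat -> quat R) T :
  (T <= K)%N ->
  (forall d, (0 < d < K)%N -> \sum_(k < K) w ^+ (k * d) = 0) -> w ^+ K = 1 ->
  \sum_(k < K) (\sum_(l < K) (rho ^+ l + rho ^+ (K - l)) *: (w ^+ k) ^+ l)
     * (\sum_(j < T) w ^+ (k * j) * x j)
  = K%:R *: \sum_(j < T) (rho ^+ j + rho ^+ (K - j)) *: x j.
Proof.
move=> TK wd wK.
under eq_bigr do rewrite mulr_sumr.
rewrite exchange_big scaler_sumr; apply: eq_bigr => j _ /=.
have jK : (j < K)%N by rewrite (leq_trans _ TK).
have K0 : (0 < K)%N by case: (K) jK.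
have wD l : \sum_(k < K) w ^+ (k * (l + j)) =
   if ((l + j) %% K == 0)%N then K%:R%:A else 0.
  under eq_bigr => k _.
    rewrite {1}(divn_eq (l + j) K) mulnDr exprD mulnA mulnC exprM.
    rewrite wK expr1n mul1r.
    over.
  case: eqP => [->|/eqP m0].
    under eq_bigr do rewrite muln0 expr0.
    by rewrite sumr_const card_ord scaler_nat.
  by apply: wd; rewrite lt0n m0 ltn_mod.
transitivity ((\sum_(l < K) (rho ^+ l + rho ^+ (K - l)) *:
    \sum_(k < K) w ^+ (k * (l + j))) * x j).
  under [in RHS]eq_bigr do rewrite scaler_sumr.
  rewrite exchange_big mulr_suml; apply: eq_bigr => k _.
  rewrite mulrA mulr_suml; congr (_ * _); apply: eq_bigr => l _.
  by rewrite -scalerAl -exprM -exprD -mulnDr.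
under eq_bigr do rewrite wD.
(* Only the index l with l + j = 0 modulo K survives. *)
have [j0|j0] := posnP j.
  rewrite (bigD1 (Ordinal K0))//= big1 => [|i i0].
    by rewrite j0 addn0 mod0n eqxx addr0 -scalerAl -scalerAl mul1r !scalerA mulrC.
  rewrite j0 addn0 modn_small//; case: eqP; rewrite ?scaler0// => i00.
  by case/negP: i0; apply/eqP/val_inj.
have KjK : (K - j < K)%N by rewrite ltn_subrL j0.
rewrite (bigD1 (Ordinal KjK))//= big1 => [|i i0].
  rewrite subnK 1?ltnW// modnn eqxx addr0 -scalerAl -scalerAl mul1r !scalerA.
  by rewrite mulrC subKn 1?ltnW// [rho ^+ (K - j) + _]addrC.
case: eqP; rewrite ?scaler0// => /eqP; rewrite -/(dvdn _ _) => /dvdnP[c ec].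
case/negP: i0; apply/eqP/val_inj => /=; move: ec (ltn_ord i).
case: c => [|[|c]]; rewrite ?mulSn ?mul0n; lia.
Qed.

(** The value at rho z is an average, with the nonnegative weights of the
    discrete Poisson kernel, of the values at the points w^k z of the sphere of
    z, up to an error that vanishes with the number K of points. The weights act
    on the left and the coefficients sit on the right, so noncommutativity does
    no harm. *)
Lemma polynomial_maximum_principle (rho M : R) (b : nat -> quat R) z T :
  0 <= rho < 1 ->
  (forall p, `|p| = `|z| -> `|\sum_(j < T) p ^+ j * b j| <= M) ->
  `|\sum_(j < T) (rho *: z) ^+ j * b j| <= M.
Proof.
move=> rho01 hM; have /andP[rho0 rho1] := rho01.
have M0 : 0 <= M by apply: le_trans (hM z erefl).
pose x j := z ^+ j * b j.
pose B := \sum_(j < T) `|x j|.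
have key K : (T < K)%N ->
  `|\sum_(j < T) rho ^+ j *: x j| <= M + rho ^+ (K - T) * (M + B).
  move=> TK; have K0 : (0 < K)%N by case: (K) TK.
  have [w [wz wK wd]] := root_of_unity_exists z K0.
  have w1 : `|w| = 1 := quat_norm_unity_root K0 wK.
  pose S k := \sum_(l < K) (rho ^+ l + rho ^+ (K - l)) *: (w ^+ k) ^+ l.
  have E := discrete_poisson_sum rho x (ltnW TK) wd wK.
  have E1 := discrete_poisson_sum rho (fun=> 1) K0 wd wK.
  have S_real k : exists2 t : R, 0 <= t & S k = t%:A.
    by apply: discrete_poisson_real => //; rewrite -exprM mulnC exprM wK expr1n.
  have /(_ _)/cid2 S_real' := S_real.
  pose t k := projT1 (S_real' k).
  have t0 k : 0 <= t k by rewrite /t; case: (S_real' k).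
  have tS k : S k = (t k)%:A by rewrite /t; case: (S_real' k).
  have sumt : \sum_(k < K) t k = K%:R * (1 + rho ^+ K).
    move: E1; rewrite !big_ord1 subn0 expr0.
    under eq_bigr do rewrite big_ord1 muln0 expr0 !mulr1 -/(S _) tS.
    by rewrite -scaler_suml scalerA => /(congr1 (@q0 R)) /=; rewrite !mulr1.
  have bound : `|K%:R *: \sum_(j < T) (rho ^+ j + rho ^+ (K - j)) *: x j|
      <= K%:R * (1 + rho ^+ K) * M.
    rewrite -E -sumt mulr_suml; apply: (le_trans (ler_norm_sum _ _ _)).
    apply: ler_sum => k _; rewrite -/(S k) tS -scalerAl mul1r normrZ.
    rewrite ger0_norm// ler_wpM2l//.
    have -> : \sum_(j < T) w ^+ (k * j) * x j
        = \sum_(j < T) (w ^+ k * z) ^+ j * b j.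
      apply: eq_bigr => j _; rewrite exprMn_comm; last first.
        by apply/commr_sym/commrX/commr_sym.
      by rewrite -exprM mulrA.
    by apply: hM; rewrite quat_normM quat_normX w1 expr1n mul1r.
  move: bound; rewrite normrZ ger0_norm ?ler0n// -mulrA ler_pM2l ?ltr0n//.
  under eq_bigr do rewrite scalerDl.
  rewrite big_split /=; set A := (X in `|X + _|); set A' := (X in `|_ + X|).
  move=> bound.
  have A'B : `|A'| <= rho ^+ (K - T) * B.
    rewrite mulr_sumr; apply: (le_trans (ler_norm_sum _ _ _)).
    apply: ler_sum => j _; rewrite normrZ ger0_norm ?exprn_ge0//.
    by rewrite ler_wpM2r// ler_wiXn2l ?(ltW rho1)// leq_sub2l// ltnW.
  have rKT : rho ^+ K <= rho ^+ (K - T) by rewrite ler_wiXn2l ?(ltW rho1)// leq_subr.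
  have : `|A| <= `|A + A'| + `|A'|.
    by rewrite -{1}(addrK A' A); apply: ler_normB.
  have := ler_wpM2r M0 rKT.
  rewrite mulrDl mul1r in bound; rewrite mulrDr; lra.
have -> : \sum_(j < T) (rho *: z) ^+ j * b j = \sum_(j < T) rho ^+ j *: x j.
  by apply: eq_bigr => j _; rewrite exprZn scalerAl.
apply: (le_geometric_error rho01 (D := M + B)) => m.
have TTm : (T < T + m.+1)%N by rewrite addnS ltnS leq_addr.
apply: (le_trans (key _ TTm)); rewrite addKn lerD2l mulrC ler_wpM2l ?addr_ge0 ?sumr_ge0//.
by rewrite ler_wiXn2l// ltW.
Qed.

End PolynomialMaximumPrinciple.

(** * Power series on the unit ball *)

Section PowerSeries.
Variable R : realType.
Implicit Types (p q x z : quat R) (s t C kappa : R) (a b : nat -> quat R)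
  (F G : quat R -> quat R).

Lemma bounded_by_geometric_cvg (v : nat -> R) C kappa : 0 <= kappa < 1 ->
  (forall m, `|v m| <= C * kappa ^+ m) -> cvgn (series v).
Proof.
move=> /andP[k0 k1] vC; apply: normed_cvg.
apply: (@series_le_cvg _ _ (geometric C kappa)) => //.
- by move=> m /=.
- by move=> m; apply: le_trans (vC m).
- by apply: is_cvg_geometric_series; rewrite ger0_norm.
Qed.

(** Completeness of the quaternions, reduced to that of the reals one component
    at a time. *)
Lemma quat_series_cvg (u : nat -> quat R) C kappa : 0 <= kappa < 1 ->
  (forall m, `|u m| <= C * kappa ^+ m) -> exists l : quat R, series u @ \oo --> l.
Proof.
move=> k01 uC.
have cv (pr : quat R -> R) : (forall q, `|pr q| <= `|q|) ->
    cvgn (series (fun m => pr (u m))).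
  by move=> prq; apply: (bounded_by_geometric_cvg k01) => m; apply: le_trans (uC m).
pose L pr := limn (series (fun m => pr (u m))) : R.
exists (Quat (L (@q0 R)) (L (@q1 R)) (L (@q2 R)) (L (@q3 R))).
have close (pr : quat R -> R) (e : R) : 0 < e -> (forall q, `|pr q| <= `|q|) ->
    \forall n \near \oo, `|L pr - series (fun m => pr (u m)) n| < e.
  by move=> e0 /cv /cvgrPdist_lt; apply.
apply/cvgrPdist_lt => e e0.
have e4 : 0 < e / 4 by rewrite divr_gt0.
have c0 q := let: And4 h _ _ _ := quat_component_le q in h.
have c1 q := let: And4 _ h _ _ := quat_component_le q in h.
have c2 q := let: And4 _ _ h _ := quat_component_le q in h.
have c3 q := let: And4 _ _ _ h := quat_component_le q in h.
near=> n; apply: (le_lt_trans (quat_norm_le_sum _)) => /=.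
have E0 : q0 (series u n) = series (fun m => q0 (u m)) n.
  by rewrite !seriesEnat /=; elim/big_ind2 : _ => // ? x ? y <- <-.
have E1 : q1 (series u n) = series (fun m => q1 (u m)) n.
  by rewrite !seriesEnat /=; elim/big_ind2 : _ => // ? x ? y <- <-.
have E2 : q2 (series u n) = series (fun m => q2 (u m)) n.
  by rewrite !seriesEnat /=; elim/big_ind2 : _ => // ? x ? y <- <-.
have E3 : q3 (series u n) = series (fun m => q3 (u m)) n.
  by rewrite !seriesEnat /=; elim/big_ind2 : _ => // ? x ? y <- <-.
rewrite E0 E1 E2 E3.
have h0 : `|L (@q0 R) - series (fun m => q0 (u m)) n| < e / 4.
  by near: n; exact: close.
have h1 : `|L (@q1 R) - series (fun m => q1 (u m)) n| < e / 4.
  by near: n; exact: close.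
have h2 : `|L (@q2 R) - series (fun m => q2 (u m)) n| < e / 4.
  by near: n; exact: close.
have h3 : `|L (@q3 R) - series (fun m => q3 (u m)) n| < e / 4.
  by near: n; exact: close.
lra.
Unshelve. all: by end_near. Qed.

Lemma series_geometric_remainder (u : nat -> quat R) (l : quat R) C kappa T :
  0 <= kappa < 1 -> (forall m, `|u m| <= C * kappa ^+ m) ->
  series u @ \oo --> l ->
  `|l - series u T| <= C * kappa ^+ T / (1 - kappa).
Proof.
move=> /andP[k0 k1] uC ul.
have C0 : 0 <= C by have := uC 0%N; rewrite expr0 mulr1; apply: le_trans.
have k1' : 0 < 1 - kappa by rewrite subr_gt0.
apply/ler_addgt0Pl => e e0.
move/cvgrPdist_lt: ul => /(_ e e0)[n _ /(_ (T + n)%N (leq_addl _ _)) /= ln].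
have fin : `|series u (T + n)%N - series u T| <= C * kappa ^+ T / (1 - kappa).
  rewrite sub_series_geq ?leq_addr//.
  apply: (le_trans (ler_norm_sum _ _ _)).
  apply: (@le_trans _ _ (\sum_(T <= k < T + n) C * kappa ^+ k)).
    by apply: ler_sum => k _.
  rewrite -{1}[T]add0n big_addn addKn big_mkord.
  rewrite ler_pdivlMr//.
  under eq_bigr do rewrite exprD [_ ^+ _ * _]mulrC mulrA.
  rewrite -mulr_sumr -[leLHS]mulrA ler_piMr ?mulr_ge0 ?exprn_ge0//.
  have := subrX1 kappa n => /eqP; rewrite -subr_eq0 => /eqP e1.
  rewrite [_ * (1 - kappa)](_ : _ = 1 - kappa ^+ n).
    by rewrite lerBlDr lerDl exprn_ge0.
  by rewrite mulrC -[1 - kappa]opprB mulNr -subrX1 opprB.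
rewrite -(subrKA (series u (T + n)%N)).
apply: (le_trans (ler_normD _ _)); apply: lerD => //; exact: ltW.
Qed.

(** The radius of convergence of sum_m q^m a_m is at least 1. Bounds on the
    coefficients are used in place of convergence because they pass easily to
    convolutions. *)
Definition unit_radius a :=
  forall s, 0 < s < 1 -> exists C, forall m, s ^+ m * `|a m| <= C.

Lemma norm_monomial_le s C a q m : 0 < s ->
  (forall k, s ^+ k * `|a k| <= C) -> `|q ^+ m * a m| <= C * (`|q| / s) ^+ m.
Proof.
move=> s0 /(_ m) aC; rewrite quat_normM quat_normX expr_div_n.
rewrite [C * _]mulrCA ler_wpM2l ?exprn_ge0// ler_pdivlMr ?exprn_gt0//.
by rewrite mulrC.
Qed.

Lemma between_norm_and_1 q : `|q| < 1 -> exists2 s, 0 < s < 1 & `|q| < s.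
Proof.
move=> q1; exists ((`|q| + 1) / 2).
  by have := normr_ge0 q; move=> ?; apply/andP; split; lra.
by lra.
Qed.

Lemma ratio_itv t s : 0 <= t -> t < s -> 0 <= t / s < 1.
Proof.
move=> t0 ts; have s0 : 0 < s by apply: le_lt_trans ts.
by rewrite divr_ge0// ?ltW//= ltr_pdivrMr// mul1r.
Qed.

Lemma power_series_expansion a : unit_radius a ->
  has_expansion (power_series a) a.
Proof.
move=> ra q q1; have [s s01 qs] := between_norm_and_1 q1.
have [C aC] := ra s s01; have /andP[s0 _] := s01.
have [l ul] := quat_series_cvg (ratio_itv (normr_ge0 q) qs)
  (fun m => norm_monomial_le q m s0 aC).
by rewrite /power_series; move/cvg_lim : (ul) => ->//; exact: norm_hausdorff.
Qed.

Lemma expansion_unit_radius F a : has_expansion F a -> unit_radius a.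
Proof.
move=> Fa s /andP[s0 s1].
have /Fa /cvgP/cvg_series_cvg_0 : qball 1 (s%:A : quat R).
  by rewrite /qball /= quat_norm_scalar gtr0_norm.
move=> /cvgP/cvg_seq_bounded/ex_strict_bound_gt0[C C0 hC].
exists C => m; have /ltW := hC m I; rewrite quat_normM quat_normX.
by rewrite quat_norm_scalar gtr0_norm.
Qed.

Lemma expansion_remainder F a s : has_expansion F a -> 0 < s < 1 ->
  exists2 C, 0 <= C & forall q T, `|q| < s ->
  `|F q - \sum_(m < T) q ^+ m * a m| <= C * (`|q| / s) ^+ T / (1 - `|q| / s).
Proof.
move=> Fa s01; have /andP[s0 s1] := s01.
have [C aC] := expansion_unit_radius Fa s01; exists C.
  by have := aC 0%N; rewrite expr0 mul1r; apply: le_trans.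
move=> q T qs.
have := series_geometric_remainder T (ratio_itv (normr_ge0 q) qs)
  (fun m => norm_monomial_le q m s0 aC) (Fa q (lt_trans qs s1)).
by rewrite seriesEord.
Qed.

(** Taylor's formula at the origin; only the exponent T matters, the constants 2
    and 4 come from comparing with a geometric series on the ball of radius
    1/2. *)
Lemma expansion_remainder_near0 F a : has_expansion F a ->
  exists2 C, 0 <= C & forall q T, `|q| <= 4^-1 ->
  `|F q - \sum_(m < T) q ^+ m * a m| <= C * (2 * `|q|) ^+ T.
Proof.
move=> Fa; have [||C C0 FC] := @expansion_remainder F a 2^-1 => //.
  by apply/andP; split; lra.
exists (2 * C) => [|q T q4]; first by rewrite mulr_ge0.
have /FC - /(_ T) : `|q| < 2^-1 by lra.
move=> /le_trans; apply.
rewrite invrK [`|q| * 2]mulrC ler_pdivrMr; last by lra.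
have : 0 <= C * (2 * `|q|) ^+ T by rewrite mulr_ge0 ?exprn_ge0 ?mulr_ge0.
set X := C * _; have -> : 2 * C * (2 * `|q|) ^+ T = 2 * X by rewrite /X mulrA.
move=> X0; rewrite mulrAC ler_peMl//; lra.
Qed.

(** If the coefficients agree below N, comparing both Taylor formulas of order
    N + 1 at a small real point t gives t^N |a_N - b_N| = O(t^(N+1)). *)
Lemma expansion_unique F a b : has_expansion F a -> has_expansion F b -> a = b.
Proof.
move=> Fa Fb; have [A A0 FA] := expansion_remainder_near0 Fa.
have [B B0 FB] := expansion_remainder_near0 Fb.
apply/funext; elim/ltn_ind => N IH.
apply/eqP; rewrite -subr_eq0 -normr_le0; apply/ler_addgt0Pr => e e0.
rewrite add0r.
pose t := Num.min 4^-1 (e / ((A + B) * 2 ^+ N.+1 + 1)).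
have D0 : 0 < (A + B) * 2 ^+ N.+1 + 1.
  by rewrite ltr_wpDl// mulr_ge0 ?addr_ge0.
have t0 : 0 < t by rewrite lt_min divr_gt0// invr_gt0 ltr0n.
have tq : `|t%:A : quat R| = t by rewrite quat_norm_scalar gtr0_norm.
have t4 : `|t%:A : quat R| <= 4^-1 by rewrite tq ge_min lexx.
have := FA _ N.+1 t4; have := FB _ N.+1 t4; rewrite tq.
rewrite !big_ord_recr /=.
have -> : \sum_(i < N) t%:A ^+ i * a i = \sum_(i < N) t%:A ^+ i * b i.
  by apply: eq_bigr => i _; rewrite IH.
set S := \sum_(i < N) _ => hb ha.
have : `|t%:A ^+ N * (a N - b N)| <= (A + B) * (2 * t) ^+ N.+1.
  have -> : t%:A ^+ N * (a N - b N) =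
      (F t%:A - (S + t%:A ^+ N * b N)) - (F t%:A - (S + t%:A ^+ N * a N)).
    by rewrite mulrBr opprB [RHS]addrC subrKA opprD addrACA subrr add0r.
  by apply: (le_trans (ler_normB _ _)); rewrite mulrDl addrC lerD.
rewrite quat_normM quat_normX tq [(2 * t) ^+ _]exprMn [t ^+ N.+1]exprSr.
rewrite !mulrA mulrAC [_ * t ^+ N]mulrC ler_pM2l ?exprn_gt0// => /le_trans; apply.
have : t <= e / ((A + B) * 2 ^+ N.+1 + 1) by rewrite ge_min lexx orbT.
by rewrite ler_pdivlMr// mulrDr mulr1 => h; rewrite mulrC; lra.
Qed.

Lemma coefs_expansion F a : has_expansion F a -> coefs F = a.
Proof.
move=> Fa; apply: (expansion_unique _ Fa).
exact: (@xgetPex _ (fun=> 0) [set a | has_expansion F a] (ex_intro _ a Fa)).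
Qed.

Lemma coefs_no_expansion F : ~ (exists a, has_expansion F a) ->
  coefs F = fun=> 0.
Proof. by move=> nF; apply: xgetPN => a Fa; apply: nF; exists a. Qed.

(** Holds for every function: the coefficients of a function without expansion
    are zero. *)
Lemma coefs_unit_radius F : unit_radius (coefs F).
Proof.
have [[a Fa]|nF] := pselect (exists a, has_expansion F a).
  by rewrite (coefs_expansion Fa); exact: expansion_unit_radius Fa.
by rewrite coefs_no_expansion// => s _; exists 0 => m; rewrite normr0 mulr0.
Qed.

Lemma slice_derivative_expansion F a : has_expansion F a ->
  slice_derivative F 0 = a 1%N.
Proof.
move=> Fa; have [C C0 FC] := expansion_remainder_near0 Fa.
apply: cvg_lim; first exact: norm_hausdorff.
have F0 : F 0 = a 0%N.
  have := FC 0 1%N; rewrite normr0 invr_ge0 ler0n => /(_ isT).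
  rewrite big_ord1 expr0 mul1r mulr0 expr1 mulr0 normr_le0 subr_eq0.
  by move=> /eqP.
apply/cvgrPdist_le => e e0.
have D0 : 0 < 4 * C + 1 by rewrite ltr_wpDl// mulr_ge0.
pose d := Num.min 4^-1 (e / (4 * C + 1)).
have d0 : 0 < d by rewrite lt_min divr_gt0// invr_gt0 ltr0n.
near=> h.
have h0 : h != 0 by near: h; exact: nbhs_dnbhs_neq.
have hq : `|h%:A : quat R| = `|h| by exact: quat_norm_scalar.
have hd : `|h| <= d by near: h; apply: dnbhs0_le.
have h4 : `|h%:A : quat R| <= 4^-1 by rewrite hq (le_trans hd)// ge_min lexx.
have := FC _ 2%N h4; rewrite hq big_ord_recl big_ord1 /= expr0 expr1 mul1r.
rewrite addr0 F0.
have -> : a 1%N - h^-1 *: (F h%:A - a 0%N) =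
  - (h^-1 *: (F h%:A - (a 0%N + h%:A * a 1%N))).
  rewrite -scalerAl mul1r opprD addrA [in RHS]scalerBr scalerA mulVf//.
  by rewrite scale1r opprB.
rewrite normrN normrZ normfV => hC.
rewrite ler_pdivrMl ?normr_gt0//; apply: (le_trans hC).
rewrite [leLHS](_ : _ = `|h| * (4 * C * `|h|)); last by ring.
rewrite ler_wpM2l//.
have : `|h| <= e / (4 * C + 1) by rewrite (le_trans hd)// ge_min lexx orbT.
rewrite ler_pdivlMr//; have := normr_ge0 h; lra.
Unshelve. all: by end_near. Qed.

End PowerSeries.

(** * Leading terms of star products *)

Section StarProducts.
Variable R : realType.
Implicit Types (p q u v : quat R) (s t C : R) (a b c : nat -> quat R)
  (F G f : quat R -> quat R).

Definition convolution a b m : quat R := \sum_(k < m.+1) a k * b (m - k)%N.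

(** If s < s' < 1, the bounds at s' give |c_m| s^m <= A B (m + 1) (s / s')^m, and
    (m + 1) kappa^m is at most 1 + kappa + ... + kappa^m. *)
Lemma unit_radius_convolution a b :
  unit_radius a -> unit_radius b -> unit_radius (convolution a b).
Proof.
move=> ra rb s s01; have /andP[s0 s1] := s01.
have [s' s'01 ss'] : exists2 s', 0 < s' < 1 & s < s'.
  by exists ((s + 1) / 2); first apply/andP; try split; lra.
have [A aA] := ra s' s'01; have [B bB] := rb s' s'01.
have A0 : 0 <= A by have := aA 0%N; rewrite expr0 mul1r; apply: le_trans.
have B0 : 0 <= B by have := bB 0%N; rewrite expr0 mul1r; apply: le_trans.
have /andP[s'0 s'1] := s'01.
have /andP[k0 k1] := ratio_itv (ltW s0) ss'; set kappa := s / s' in k0 k1.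
exists (A * B / (1 - kappa)) => m.
have -> : s ^+ m = kappa ^+ m * s' ^+ m.
  by rewrite -exprMn divfK// gt_eqF.
have step : s' ^+ m * `|convolution a b m| <= \sum_(k < m.+1) A * B.
  apply: (le_trans (ler_wpM2l (exprn_ge0 _ (ltW s'0)) (ler_norm_sum _ _ _))).
  rewrite mulr_sumr; apply: ler_sum => k _.
  have -> : s' ^+ m * `|a k * b (m - k)%N| =
      (s' ^+ k * `|a k|) * (s' ^+ (m - k) * `|b (m - k)%N|).
    by rewrite mulrACA -exprD subnKC ?quat_normM// -ltnS.
  by rewrite ler_pM// mulr_ge0// exprn_ge0// ltW.
rewrite -mulrA; apply: (le_trans (ler_wpM2l (exprn_ge0 _ k0) step)).
rewrite mulr_sumr ler_pdivlMr ?subr_gt0//.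
apply: (@le_trans _ _ ((\sum_(k < m.+1) kappa ^+ k) * (A * B) * (1 - kappa))).
  rewrite ler_wpM2r ?subr_ge0 ?(ltW k1)// mulr_suml; apply: ler_sum => k _.
  by rewrite ler_wpM2r ?mulr_ge0// ler_wiXn2l// ?(ltW k1)// -ltnS.
rewrite mulrAC ler_piMl ?mulr_ge0//.
by rewrite mulrC -[1 - kappa]opprB mulNr -subrX1 opprB lerBlDr lerDl exprn_ge0.
Qed.

(** Only the modulus of the leading coefficient is recorded: unlike the
    coefficient itself, it does not depend on the order of the factors of a
    star product. *)
Definition leading_term F N (l : R) := exists c,
  [/\ has_expansion F c, forall m, (m < N)%N -> c m = 0 & `|c N| = l].

Lemma leading_term_cst1 : leading_term (cst 1) 0 1.
Proof.
exists (fun m => (m == 0%N)%:R); split => //; last by rewrite quat_norm1.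
move=> q q1; apply: cvg_near_cst.
exists 1%N => // n /= n0; apply/eqP; rewrite seriesEord.
case: n n0 => // n _; rewrite /= big_ord_recl expr0 mulr1 big1 ?addr0// => i _.
by rewrite mulr0.
Qed.

(** The modulus is multiplicative, and the lowest coefficient of a convolution
    is the product of the lowest coefficients. *)
Lemma leading_term_star F G M N k l : leading_term F M k ->
  leading_term G N l -> leading_term (star F G) (M + N) (k * l).
Proof.
move=> [a [Fa a0 <-]] [b [Gb b0 <-]]; exists (convolution a b); split.
- rewrite /star (coefs_expansion Fa) (coefs_expansion Gb).
  apply: power_series_expansion; apply: unit_radius_convolution.
    exact: expansion_unit_radius Fa.
  exact: expansion_unit_radius Gb.
- move=> m mMN; rewrite /convolution big1// => i _.
  have [iM|Mi] := ltnP i M; first by rewrite a0// mul0r.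
  by rewrite b0 ?mulr0//; have := ltn_ord i; lia.
- have MMN : (M < (M + N).+1)%N by lia.
  rewrite /convolution (bigD1 (Ordinal MMN))//= big1 => [|i iM].
    by rewrite addr0 addKn quat_normM.
  have {}iM : (i != M :> nat) by apply: contra iM => /eqP iM; apply/eqP/val_inj.
  have [iM'|Mi] := ltnP i M; first by rewrite a0// mul0r.
  by rewrite b0 ?mulr0//; have := ltn_ord i; lia.
Qed.

Lemma rotate_expansion f u : `|u| <= 1 ->
  has_expansion (rotate f u) (fun m => u ^+ m * coefs f m).
Proof.
move=> u1; apply: power_series_expansion => s s01.
have [C fC] := coefs_unit_radius f s01; exists C => m.
apply: le_trans (fC m); have /andP[/ltW s0 _] := s01.
by rewrite ler_wpM2l ?exprn_ge0// quat_normM quat_normX ler_piMl// exprn_ile1.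
Qed.

Lemma has_expansionB F G a b : has_expansion F a -> has_expansion G b ->
  has_expansion (F \- G) (fun m => a m - b m).
Proof.
move=> Fa Gb q q1; have := cvgB (Fa q q1) (Gb q q1).
rewrite [X in X @ _](_ : _ = series (fun m => q ^+ m * (a m - b m))); first exact.
apply/funext => n; rewrite !seriesEnat /= -[LHS]/(_ - _) -sumrB.
by apply: eq_bigr => m _; rewrite mulrBr.
Qed.

(** The constant terms of f_u and f_v are both a_0, so they cancel. *)
Lemma leading_term_rotateB f u v : `|u| <= 1 -> `|v| <= 1 ->
  leading_term (rotate f u \- rotate f v) 1 (`|u - v| * `|coefs f 1%N|).
Proof.
move=> u1 v1; have E := has_expansionB (rotate_expansion (f := f) u1)
  (rotate_expansion (f := f) v1).
eexists; split; first exact: E.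
  by case=> // _; rewrite !expr0 subrr.
by rewrite /= !expr1 -mulrBl quat_normM.
Qed.

Definition pair_count n : nat :=
  (\sum_(j < n) \sum_(k < n | j < k) 1)%N.

(** The order e of the factors is a parameter for the sake of factors that
    vanish identically, which have every order with A = 0. *)
Lemma leading_term_star_vandermonde n f (w : 'I_n -> quat R) e (A : R) :
  (forall j k, leading_term (rotate f (w k) \- rotate f (w j)) e (`|w k - w j| * A)) ->
  leading_term (star_vandermonde f w) (e * pair_count n)
    ((\prod_(j < n) \prod_(k < n | (j < k)%N) `|w k - w j|) * A ^+ pair_count n).
Proof.
move=> wA.
pose K F N l := leading_term F (e * N) (l * A ^+ N).
have K1 : K (cst 1) 0%N 1 by rewrite /K muln0 mulr1; exact: leading_term_cst1.
have KM F M k G N l : K F M k -> K G N l -> K (star F G) (M + N)%N (k * l).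
  rewrite /K mulnDr exprD mulrACA; exact: leading_term_star.
rewrite -/(K _ (pair_count n) _) /pair_count /star_vandermonde.
elim/big_ind3 : _ => // [? ? ? ? ? ?|j _]; first exact: KM.
elim/big_ind3 : _ => // [? ? ? ? ? ?|k jk]; first exact: KM.
by rewrite /K muln1 expr1.
Qed.

End StarProducts.

(** * Schwarz lemma *)

Section SchwarzLemma.
Variable R : realType.
Implicit Types (p q u v : quat R) (s t C : R) (a b c : nat -> quat R)
  (F G f : quat R -> quat R).

Lemma expansion_remainder_uniform F a s : has_expansion F a -> 0 < s < 1 ->
  exists C kappa, [/\ 0 <= C, 0 <= kappa < 1 & forall q T, `|q| <= s ->
  `|F q - \sum_(m < T) q ^+ m * a m| <= C * kappa ^+ T].
Proof.
move=> Fa /andP[s0 s1].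
have [s' s'01 ss'] : exists2 s', 0 < s' < 1 & s < s'.
  by exists ((s + 1) / 2); first apply/andP; try split; lra.
have [C C0 FC] := expansion_remainder Fa s'01.
have /andP[s'0 s'1] := s'01.
have /andP[k0 k1] := ratio_itv (ltW s0) ss'.
exists (C / (1 - s / s')), (s / s'); split; first 2 last.
- move=> q T qs; apply: (le_trans (FC q T (le_lt_trans qs ss'))).
  rewrite mulrAC; have qk : `|q| / s' <= s / s' by rewrite ler_pM2r ?invr_gt0.
  rewrite ler_pM ?mulr_ge0 ?invr_ge0 ?subr_ge0 ?exprn_ge0 ?(ltW k1)//.
  + exact: ltW (le_lt_trans qk k1).
  + by rewrite divr_ge0// ltW.
  + rewrite ler_wpM2l// lef_pV2 ?posrE ?subr_gt0//; last exact: le_lt_trans k1.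
    by rewrite lerB.
  + by rewrite lerXn2r ?nnegrE// divr_ge0// ltW.
- by rewrite divr_ge0// subr_ge0 ltW.
- by rewrite k0.
Qed.

(** Dividing F by q^N gives the series G with coefficients c_(N + j), bounded by
    M / s^N on the sphere of radius s. The maximum principle applied to the
    partial sums of G carries this bound into the ball; G is then evaluated at
    0, and at q. *)
Lemma schwarz_sphere F c N (M s : R) : has_expansion F c ->
  (forall m, (m < N)%N -> c m = 0) -> 0 < s < 1 ->
  (forall p, `|p| = s -> `|F p| <= M) ->
  `|c N| * s ^+ N <= M /\
  forall q, `|q| < s -> `|F q| * s ^+ N <= `|q| ^+ N * M.
Proof.
move=> Fc c0 s01 FM; have /andP[s0 s1] := s01.
have [C [kappa [C0 k01 FC]]] := expansion_remainder_uniform Fc s01.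
have /andP[k0 k1] := k01.
pose G T q := \sum_(j < T) q ^+ j * c (N + j)%N.
have FG q T : \sum_(m < N + T) q ^+ m * c m = q ^+ N * G T q.
  rewrite big_split_ord /= big1 ?add0r => [|i _]; last by rewrite c0 ?mulr0.
  by rewrite mulr_sumr; apply: eq_bigr => j _; rewrite exprD mulrA.
have kN T : C * kappa ^+ (N + T) <= C * kappa ^+ T.
  by rewrite ler_wpM2l// ler_wiXn2l// ?ltW// leq_addl.
have sphere p T : `|p| = s -> `|G T p| <= (M + C * kappa ^+ T) / s ^+ N.
  move=> ps; rewrite ler_pdivlMr ?exprn_gt0//.
  rewrite -{1}ps -quat_normX mulrC -quat_normM -FG.
  have := FC p (N + T)%N; rewrite ps lexx => /(_ isT) h.
  rewrite -[X in `|X|](subKr (F p)); apply: (le_trans (ler_normB _ _)).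
  by rewrite lerD ?FM// (le_trans h).
have ball q T : `|q| < s -> `|G T q| <= (M + C * kappa ^+ T) / s ^+ N.
  move=> qs.
  have [z zs qz] : exists2 z, `|z| = s & q = (`|q| / s) *: z.
    have [->|q0] := eqVneq q 0.
      exists s%:A; first by rewrite quat_norm_scalar gtr0_norm.
      by rewrite normr0 mul0r scale0r.
    have q0' : `|q| != 0 by rewrite normr_eq0.
    exists ((s / `|q|) *: q).
      by rewrite normrZ ger0_norm ?divr_ge0 ?(ltW s0)// divfK.
    by rewrite scalerA mulrA divfK ?divff ?scale1r// gt_eqF.
  rewrite qz; apply: (polynomial_maximum_principle (b := fun j => c (N + j)%N)).
    exact: ratio_itv.
  by move=> p pz; apply: sphere; rewrite pz.
split.
  apply: (le_geometric_error k01 (D := C)) => T.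
  rewrite -ler_pdivlMr ?exprn_gt0//.
  have := @ball 0 T.+1; rewrite normr0 => /(_ s0).
  rewrite /G big_ord_recl expr0 mul1r addn0 big1 ?addr0 => [|i _]; last first.
    by rewrite expr0n mul0r.
  move=> /le_trans; apply; rewrite ler_pM2r ?invr_gt0 ?exprn_gt0// lerD2l.
  by rewrite ler_wpM2l// ler_wiXn2l// ltW.
move=> q qs; apply: (le_geometric_error k01 (D := C + C)) => T.
have qN : `|q| ^+ N <= 1 by rewrite exprn_ile1// ltW// (lt_trans qs).
have sN : s ^+ N <= 1 by rewrite exprn_ile1// ltW.
have e0 : 0 <= C * kappa ^+ T by rewrite mulr_ge0// exprn_ge0.
have h1 := le_trans (FC q (N + T)%N (ltW qs)) (kN T).
have h2 := ball q T qs; rewrite ler_pdivlMr ?exprn_gt0// in h2.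
rewrite FG in h1.
rewrite -[F q](subrK (q ^+ N * G T q)).
apply: (le_trans (ler_wpM2r (exprn_ge0 _ (ltW s0)) (ler_normD _ _))).
have h3 : `|q ^+ N * G T q| * s ^+ N <= `|q| ^+ N * M + C * kappa ^+ T.
  rewrite quat_normM quat_normX -mulrA.
  apply: (le_trans (ler_wpM2l (exprn_ge0 _ (normr_ge0 _)) h2)).
  by rewrite mulrDr lerD2l ler_piMl.
have h4 : `|F q - q ^+ N * G T q| * s ^+ N <= C * kappa ^+ T.
  by rewrite (le_trans _ h1)// ler_piMr.
by rewrite !mulrDl; lra.
Qed.

Lemma le_of_pow_lt1 (x y r : R) N : r < 1 ->
  (forall s, r < s -> 0 < s < 1 -> x * s ^+ N <= y) -> x <= y.
Proof.
move=> r1 xy; apply/ler_addgt0Pl => e e0.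
have xs : x * s ^+ N @[s --> (1 : R)^'-] --> x * 1 ^+ N.
  apply: cvg_at_left_filter; apply: cvgM; first exact: cvg_cst.
  exact: exprn_continuous.
rewrite expr1n mulr1 in xs; move/cvgrPdist_lt : xs => /(_ e e0) xs.
near (1 : R)^'- => s.
have s1 : s < 1 by near: s; exact: nbhs_left_lt.
have s0 : 0 < s by near: s; exact: nbhs_left_gt.
have rs : r < s by near: s; exact: nbhs_left_gt.
have : `|x - x * s ^+ N| < e by near: s.
have := xy s rs; rewrite s0 s1 => /(_ isT).
move=> h /ltr_normlW; lra.
Unshelve. all: by end_near. Qed.

(** Schwarz lemma, from the spheres of radius s by letting s tend to 1. *)
Lemma schwarz_ball F N (l M : R) : leading_term F N l ->
  (forall p, `|p| < 1 -> `|F p| <= M) ->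
  l <= M /\ forall q, `|q| < 1 -> `|F q| <= `|q| ^+ N * M.
Proof.
move=> [c [Fc c0 <-]] FM; split.
  apply: (@le_of_pow_lt1 _ _ 0 N) => // s _ s01.
  have [] // := schwarz_sphere Fc c0 s01 (M := M).
  by move=> p ps; apply: FM; rewrite ps; case/andP: s01.
move=> q q1; apply: (@le_of_pow_lt1 _ _ `|q| N) => // s qs s01.
have [|_ ->//] := schwarz_sphere Fc c0 s01 (M := M).
by move=> p ps; apply: FM; rewrite ps; case/andP: s01.
Qed.

End SchwarzLemma.

(** * The two diameters *)

Section Diameters.
Variable R : realType.
Implicit Types (p q u v : quat R) (r s t : R) (f : quat R -> quat R).

(** The number of pairs is n (n - 1) / 2, so the exponent in the diameters is its
    inverse and they are homogeneous of degree one. *)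
Lemma pair_countE n : (pair_count n * 2 = n * n.-1)%N.
Proof.
have swap : pair_count n = (\sum_(k < n) \sum_(j < n | j < k) 1)%N.
  by rewrite /pair_count (exchange_big_dep xpredT).
rewrite muln2 -addnn {1}swap -big_split /=.
transitivity (\sum_(j < n) n.-1)%N; last by rewrite sum_nat_const card_ord.
apply: eq_bigr => j _.
have -> : n.-1 = #|predC1 j| by rewrite cardC1 card_ord.
rewrite !sum1_card.
rewrite -cardUI [X in (_ + X)%N]eq_card0 ?addn0 => [|k]; last first.
  by rewrite !inE; apply/negP => /andP[]; lia.
by apply: eq_card => k; rewrite !inE -neq_ltn.
Qed.

Local Notation vdm w n := (\prod_(j < n) \prod_(k < n | (j < k)%N) `|w k - w j|).
Local Notation alpha n := (2 / (n * n.-1)%N%:R).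

Lemma vdm_ge0 n (w : 'I_n -> quat R) : 0 <= vdm w n.
Proof. by apply: prodr_ge0 => j _; apply: prodr_ge0 => k _. Qed.

Lemma vdm_scale n t (w : 'I_n -> quat R) : 0 <= t ->
  vdm (fun i => t *: w i) n = t ^+ pair_count n * vdm w n.
Proof.
move=> t0; rewrite /pair_count.
elim/big_ind3 : _ => [|a b c d e g -> ->|j _]; rewrite ?mul1r//.
  by rewrite exprD mulrACA.
elim/big_ind3 : _ => [|a b c d e g -> ->|k _]; rewrite ?mul1r//.
  by rewrite exprD mulrACA.
by rewrite expr1 -scalerBr normrZ ger0_norm.
Qed.

Lemma pair_count_gt0 n : (1 < n)%N -> (0 < pair_count n)%N.
Proof. by have := pair_countE n; case: n => [|[|n]] //= + _; case: pair_count. Qed.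

Lemma powR_pair_count n (x : R) : (1 < n)%N -> 0 <= x ->
  (x ^+ pair_count n) `^ alpha n = x.
Proof.
move=> n1 x0; rewrite -powR_mulrn// -powRrM -pair_countE natrM.
have P0 : (pair_count n)%:R != 0 :> R.
  by rewrite pnatr_eq0 -lt0n pair_count_gt0.
rewrite [X in _ `^ X](_ : _ = 1) ?powRr1//.
by field.
Qed.

Lemma powR_expK n (x : R) : (1 < n)%N -> 0 <= x ->
  (x `^ alpha n) ^+ pair_count n = x.
Proof.
move=> n1 x0; rewrite -powR_mulrn ?powR_ge0// powRAC powR_mulrn//.
exact: powR_pair_count.
Qed.

Lemma alpha_ge0 n : 0 <= alpha n :> R.
Proof. by rewrite divr_ge0// ler0n. Qed.

Lemma le_powR_alpha n (x y : R) : (1 < n)%N -> 0 <= x -> 0 <= y ->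
  (x `^ alpha n <= y) = (x <= y ^+ pair_count n).
Proof.
move=> n1 x0 y0; apply/idP/idP => h.
  rewrite -(powR_expK n1 x0) lerXn2r ?nnegrE ?powR_ge0//.
by rewrite -(powR_pair_count n1 y0) ge0_ler_powR ?nnegrE ?exprn_ge0 ?alpha_ge0.
Qed.

(** Positive because n distinct points fit in the ball, finite because distances
    are at most 2. *)
Lemma ndiam_unit_ball n : (1 < n)%N ->
  exists2 d : R, 0 < d & ndiam n (@qball R 1) = d%:E.
Proof.
move=> n1.
have up : (ndiam n (@qball R 1) <= 2%:E)%E.
  apply: ub_ereal_sup => _ [w w1 <-]; rewrite lee_fin.
  rewrite le_powR_alpha ?vdm_ge0//.
  rewrite /pair_count.
  have : 0 <= vdm w n <= 2 ^+ pair_count n.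
    rewrite /pair_count.
    elim/big_ind2 : _ => [|a b c d|j _].
    - by rewrite expr0 lexx ler01.
    - move=> /andP[a0 ab] /andP[c0 cd].
      by rewrite mulr_ge0//= exprD ler_pM.
    elim/big_ind2 : _ => [|a b c d|k _].
    - by rewrite expr0 lexx ler01.
    - move=> /andP[a0 ab] /andP[c0 cd].
      by rewrite mulr_ge0//= exprD ler_pM.
    rewrite normr_ge0 expr1 (le_trans (ler_normB _ _))//.
    by have := w1 k; have := w1 j; rewrite /qball /=; lra.
  by case/andP.
pose w (i : 'I_n) : quat R := (i%:R / n%:R)%:A.
have w1 i : qball 1 (w i).
  rewrite /qball /= quat_norm_scalar ger0_norm ?divr_ge0//.
  by rewrite ltr_pdivrMr ?mul1r ?ltr_nat// ltr0n (ltn_trans _ n1).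
have low : ((vdm w n `^ alpha n)%:E <= ndiam n (@qball R 1))%E.
  by apply: ereal_sup_ubound; exists w.
have pos : 0 < vdm w n `^ alpha n.
  apply/powR_gt0/prodr_gt0 => j _; apply: prodr_gt0 => k jk.
  rewrite normr_gt0 subr_eq0; apply/eqP => /(congr1 (@q0 R)) /=.
  rewrite !mulr1 => /mulIf; rewrite invr_neq0 ?pnatr_eq0 -?lt0n ?(ltn_trans _ n1)//.
  by move=> /(_ isT)/eqP; rewrite eqr_nat gtn_eqF.
move: low up; case: (ndiam _ _) => //= d; rewrite !lee_fin => low up.
by exists d => //; exact: lt_le_trans low.
Qed.

(** Homogeneity: dilate the points of the unit ball by r. *)
Lemma ndiam_ball_ge n (d r : R) : (1 < n)%N -> 0 < r ->
  ndiam n (@qball R 1) = d%:E -> ((r * d)%:E <= ndiam n (@qball R r))%E.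
Proof.
move=> n1 r0 nd.
have key (w : 'I_n -> quat R) : (forall i, qball 1 (w i)) ->
    ((r * vdm w n `^ alpha n)%:E <= ndiam n (@qball R r))%E.
  move=> w1; apply: ereal_sup_ubound; exists (fun i => r *: w i).
    move=> i; rewrite /qball /= normrZ gtr0_norm// -[ltRHS]mulr1 ltr_pM2l//.
    exact: w1.
  rewrite vdm_scale ?ltW// powRM ?exprn_ge0 ?vdm_ge0 ?(ltW r0)//.
  by rewrite powR_pair_count// ltW.
move: key; case: (ndiam n (qball r)) => [x||] key; last 2 first.
- exact: leey.
- by have := key (fun=> 0) (fun=> _); rewrite leNgt ltNyr; apply;
    rewrite /qball /= normr0.
rewrite lee_fin mulrC -ler_pdivlMr// -lee_fin -nd.
apply: ub_ereal_sup => _ [w w1 <-]; rewrite lee_fin ler_pdivlMr// mulrC.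
by have := key w w1; rewrite lee_fin.
Qed.

Lemma regular_ndiam_ubound n f r (w : 'I_n -> quat R) q :
  (forall i, `|w i| <= 1) -> `|q| <= r ->
  ((`|star_vandermonde f w q| `^ alpha n)%:E <= regular_ndiam n f r)%E.
Proof.
move=> w1 qr.
pose S (w : 'I_n -> quat R) : \bar R := ereal_sup
  [set (`|star_vandermonde f w q| `^ alpha n)%:E | q in [set q | `|q| <= r]].
apply: (@le_trans _ _ (S w)); apply: ereal_sup_ubound; first by exists q.
by exists w.
Qed.

Lemma regular_ndiam_le n f r (X : \bar R) :
  (forall (w : 'I_n -> quat R) q, (forall i, `|w i| <= 1) -> `|q| <= r ->
    ((`|star_vandermonde f w q| `^ alpha n)%:E <= X)%E) ->
  (regular_ndiam n f r <= X)%E.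
Proof.
move=> h; apply: ub_ereal_sup => _ [w w1 <-].
by apply: ub_ereal_sup => _ [q qr <-]; exact: h.
Qed.

Lemma regular_ndiam_monotone n f r s : r <= s ->
  (regular_ndiam n f r <= regular_ndiam n f s)%E.
Proof.
move=> rs; apply: regular_ndiam_le => w q w1 qr.
by apply: regular_ndiam_ubound => //; exact: le_trans rs.
Qed.

(** A monotone function has one-sided limits; the reflection r -> -r turns the
    left limit into a right one. *)
Lemma cvg_regular_ndiam1 n f :
  cvg (regular_ndiam n f r @[r --> 1^'-]).
Proof.
apply/cvg_ex; eexists; apply/cvg_at_leftNP.
apply: (@nonincreasing_at_right_cvge _ _ _ (BInfty _ false)) => //.
by move=> x y _ _ xy /=; apply: regular_ndiam_monotone; rewrite lerN2.
Qed.

Lemma regular_ndiam_le1 n f r : r < 1 ->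
  (regular_ndiam n f r <= regular_ndiam1 n f)%E.
Proof.
move=> r1; apply: lime_ge; first exact: cvg_regular_ndiam1.
near=> s; apply: regular_ndiam_monotone; apply: ltW.
by near: s; exact: nbhs_left_gt.
Unshelve. all: by end_near. Qed.

(** The coefficients of a function without expansion are zero; then all factors
    f_(w_k) - f_(w_j) vanish on the ball, hence so do their star products and the
    diameter. *)
Lemma diameter_has_expansion n f (d : R) : (1 < n)%N -> 0 < d ->
  regular_ndiam1 n f = d%:E -> exists a, has_expansion f a.
Proof.
move=> n1 d0 fd; apply: contrapT => nf.
have f0 := coefs_no_expansion nf.
suff : (regular_ndiam1 n f <= 0)%E by rewrite fd lee_fin leNgt d0.
apply: lime_le; first exact: cvg_regular_ndiam1.
near=> s; apply: regular_ndiam_le => w q w1 qs; rewrite lee_fin.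
have q1 : `|q| < 1.
  by apply: le_lt_trans qs _; near: s; exact: nbhs_left_lt.
have order e j k : leading_term (rotate f (w k) \- rotate f (w j)) e (`|w k - w j| * 0).
  exists (fun=> 0); split => //; last by rewrite normr0 mulr0.
  have := has_expansionB (rotate_expansion (f := f) (w1 k))
    (rotate_expansion (f := f) (w1 j)).
  by rewrite f0; congr has_expansion; apply/funext => m; rewrite !mulr0 subr0.
(* The product has every order, so that all its coefficients are zero. *)
suff -> : star_vandermonde f w q = 0.
  by rewrite normr0 powR0// mulf_neq0// invr_eq0 pnatr_eq0; case: (n) n1 => [|[]].
have vanish m : coefs (star_vandermonde f w) m = 0.
  have [c [Pc c0 _]] := leading_term_star_vandermonde (order m.+1).
  by rewrite (coefs_expansion Pc) c0// leq_pmulr ?pair_count_gt0.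
have [c [Pc _ _]] := leading_term_star_vandermonde (order 0%N).
move: (Pc) => /(_ q q1); rewrite -(coefs_expansion Pc) => h.
rewrite -(cvg_lim (@norm_hausdorff _ _) h); apply: lim_near_cst.
  exact: norm_hausdorff.
near=> N; rewrite seriesEnat /= big1// => i _.
by rewrite vanish mulr0.
Unshelve. all: by end_near. Qed.

End Diameters.

(** * Schwarz lemma for the regular diameter *)

Theorem theorem1p6 (R : realType) (n : nat) (f : quat R -> quat R)
  (n_ge2 : (2 <= n)%N) (f_reg : slice_regular f)
  (f_diam : regular_ndiam1 n f = ndiam n (qball 1)) :
  (forall r : R, 0 < r < 1 -> (regular_ndiam n f r <= ndiam n (qball r))%E) /\
  `|slice_derivative f 0| <= 1.
Proof.
have [d d0 dB] := @ndiam_unit_ball R n n_ge2.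
rewrite dB in f_diam.
have bound (w : 'I_n -> quat R) (w1 : forall i, `|w i| <= 1) p : `|p| < 1 ->
    `|star_vandermonde f w p| <= d ^+ pair_count n.
  move=> p1; rewrite -le_powR_alpha ?(ltW d0)// -lee_fin -f_diam.
  apply: le_trans (regular_ndiam_le1 n f p1).
  exact: regular_ndiam_ubound.
have schwarz (w : 'I_n -> quat R) (w1 : forall i, `|w i| <= 1) :=
  schwarz_ball (leading_term_star_vandermonde
    (fun j k => leading_term_rotateB f (w1 k) (w1 j))) (bound w w1).
split=> [r /andP[r0 r1]|].
  apply: le_trans (ndiam_ball_ge n_ge2 r0 dB).
  apply: regular_ndiam_le => w q w1 qr; rewrite lee_fin.
  have [_ /(_ q (le_lt_trans qr r1))] := schwarz w w1.
  rewrite mul1n -exprMn => Pq.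
  apply: (@le_trans _ _ (`|q| * d)); last by rewrite ler_pM2r.
  by rewrite le_powR_alpha// mulr_ge0// ltW.
have [a fa] := diameter_has_expansion n_ge2 d0 f_diam.
rewrite (slice_derivative_expansion fa) -(coefs_expansion fa).
set A := `|_|; rewrite leNgt; apply/negP => A1.
have A0 : 0 < A by exact: lt_trans A1.
suff : d <= d / A by rewrite ler_pdivlMr// -[leRHS]mulr1 ler_pM2l// leNgt A1.
rewrite -lee_fin -dB; apply: ub_ereal_sup => _ [w w1 <-]; rewrite lee_fin.
rewrite le_powR_alpha ?vdm_ge0 ?divr_ge0 ?(ltW d0) ?(ltW A0)//.
rewrite expr_div_n ler_pdivlMr ?exprn_gt0//.
by have [] := schwarz w (fun i => ltW (w1 i)).
Qed.
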